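(* Let $K$ be a field, $S=K[x_1,x_2,\ldots,x_{10}]$, and let $I$ be a squarefree monomial ideal of $S$ with $0\neq I\neq S$. Then $$\operatorname{hdepth}(I)\geq \operatorname{hdepth}(S/I)-1.$$
   Context: The polynomial ring $S=K[x_1,\ldots,x_n]$ (here $n=10$) has the standard grading. For a nonzero finitely generated graded $S$-module $M$, the Hilbert depth $\operatorname{hdepth}(M)$ is the maximal depth of a finitely generated graded $S$-module $N$ with the same Hilbert series as $M$. For squarefree monomial ideals $0\subset I\subsetneq J\subset S$, it is computed by the following known formula, which may be taken as the definition. For $0\le j\le n$ let $\alpha_j(J/I)$ be the number of squarefree monomials $u$ of degree $j$ with $u\in J\setminus I$. For $0\le k\le q\le n$ put $$\beta_k^q(J/I):=\sum_{j=0}^k (-1)^{k-j}\binom{q-j}{k-j}\alpha_j(J/I).$$ Then $\operatorname{hdepth}(J/I)=\max\{q\in\{0,\ldots,n\} : \beta_k^q(J/I)\ge 0 \text{ for all } 0\le k\le q\}$. This applies to $S/I$ (pair $I\subsetneq S$) and to $I$ (pair $0\subsetneq I$). *)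

(* Defs.v *)
From HB Require Import structures.
From mathcomp Require Import all_boot all_order all_algebra.
From mathcomp Require Export mpoly.

Set Implicit Arguments.
Unset Strict Implicit.
Unset Printing Implicit Defensive.

Import Order.TTheory GRing.Theory Num.Theory.

Local Open Scope ring_scope.

Definition squarefree_mnm (n : nat) (m : 'X_{1..n}) : bool :=
  [forall i : 'I_n, (m i <= 1)%N].

(* The ideal generated by finitely many squarefree monomials; there are only
   finitely many squarefree monomials, and membership in such an ideal is
   decidable, so boolean predicates and finite lists lose no generality. *)
Definition squarefree_monomial_ideal (K : fieldType) (n : nat)
    (I : {pred {mpoly K[n]}}) : Prop :=
  exists2 G : seq 'X_{1..n}, all (@squarefree_mnm n) G &
    forall p : {mpoly K[n]},
      p \in I <-> exists c : 'X_{1..n} -> {mpoly K[n]},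
                    p = \sum_(m <- G) c m * 'X_[m].

(* In the definitions below, the pair (J, I) stands for the quotient J / I. *)

(* 'X_{1..n < n.+1} is the finite type of monomials of degree at most n, which
   contains every squarefree monomial. *)
Definition alpha (K : fieldType) (n : nat) (J I : {pred {mpoly K[n]}})
    (j : nat) : nat :=
  #|[set m : 'X_{1..n < n.+1} |
      [&& squarefree_mnm m, mdeg m == j, 'X_[K, m] \in J & 'X_[K, m] \notin I]]|.

Definition beta (K : fieldType) (n : nat) (J I : {pred {mpoly K[n]}})
    (q k : nat) : int :=
  \sum_(j < k.+1) (-1) ^+ (k - j)%N * ('C(q - j, k - j))%:Z * (alpha J I j)%:Z.

(* The maximum is over a nonempty set: q = 0 qualifies since
   beta J I 0 0 = alpha J I 0. *)
Definition hdepth (K : fieldType) (n : nat) (J I : {pred {mpoly K[n]}}) : nat :=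
  \max_(q < n.+1 | [forall k : 'I_q.+1, 0 <= beta J I q k]) q.

(* Main.v *)
(* Let f_j be the number of squarefree monomials of degree j outside I: the
   f-vector of a simplicial complex on 10 vertices, with f_0 = 1. Write
   b(q, k) for beta_k^q(S/I); Pascal's rule gives
   b(q, k) = b(q + 1, k) + b(q, k - 1) for 1 <= k <= q + 1, and
   b(k - 1, k) = f_k. Hence, if q = hdepth(S/I), every f_k is a nonnegative
   combination of the b(q, i) >= 0 with i <= k. By linearity
   hdepth(I) >= q - 1 means b(q - 1, k) <= C(10 - q + k, k) for k < q.
   For 10 variables the Kruskal-Katona bound on f_(k+1) in terms of f_k leaves
   so few possible vectors (b(q, 0), ..., b(q, q - 1)) that this inequality
   can be checked on all of them. *)
Require Import Defs.
From HB Require Import structures.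
From mathcomp Require Import all_boot all_order all_algebra.
From mathcomp Require Import zify ring.

Set Implicit Arguments.
Unset Strict Implicit.
Unset Printing Implicit Defensive.

Import Order.TTheory GRing.Theory Num.Theory.

(** * Numerical Kruskal-Katona bounds *)

(* The Kruskal-Katona function: for a = C(m_j, j) + C(m_(j-1), j - 1) + ... with
   n >= m_j > m_(j-1) > ..., found greedily, kk n.+1 j a is
   C(m_j, j + 1) + C(m_(j-1), j) + ... *)
Fixpoint kk (n j a : nat) : nat :=
  if n is n'.+1 then
    if 'C(n, j) <= a then 'C(n, j.+1) + kk n' j.-1 (a - 'C(n, j))
    else kk n' j a
  else 0.

(** Tabulated so that the exhaustive checks only look values up. The default 0 read off for
    [j >= 10] is correct: no face has more than 10 vertices. *)
Definition kk_table : seq (seq nat) :=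
  [seq [seq kk 10 j a | a <- iota 0 'C(10, j).+1] | j <- iota 0 10].

Definition kk_bound (j a : nat) : nat := nth 0 (nth [::] kk_table j) a.

(* The numerical inequality behind the induction on vertices: a and b count the
   faces avoiding a given vertex and those containing it. *)
Lemma eckhoff_wegner (j a b : nat) :
    j < 9 -> a <= 'C(9, j.+1) -> b <= 'C(9, j) ->
  kk_bound j.+1 a + minn a (kk_bound j b) <= kk_bound j.+1 (a + b).
Proof.
have: all (fun j => all (fun a => all (fun b =>
          kk_bound j.+1 a + minn a (kk_bound j b) <= kk_bound j.+1 (a + b))
        (iota 0 'C(9, j).+1)) (iota 0 'C(9, j.+1).+1)) (iota 0 9).
  by vm_compute.
have iotaS i n : i <= n -> i \in iota 0 n.+1 by rewrite mem_iota.
move=> /allP check j_lt a_le b_le.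
have /check/allP check_j : j \in iota 0 9 by rewrite mem_iota.
by have /allP := check_j a (iotaS _ _ a_le); apply; apply: iotaS.
Qed.

(** * Face numbers of simplicial complexes *)

Section Complexes.

Variable T : finType.
Implicit Types (A B : {set T}) (F : {set {set T}}).

Definition level F (j : nat) : nat := #|[set B in F | #|B| == j]|.

Definition down_closed F := forall A B, A \subset B -> B \in F -> A \in F.

Definition deletion x F := [set B in F | x \notin B].
Definition link x F := [set B : {set T} | (x \notin B) && (x |: B \in F)].

Lemma down_closed_deletion x F : down_closed F -> down_closed (deletion x F).
Proof.
move=> dF A B sAB; rewrite !inE => /andP[FB xB]; rewrite (dF _ _ sAB FB) /=.
by apply: contra xB; apply: (subsetP sAB).
Qed.

Lemma down_closed_link x F : down_closed F -> down_closed (link x F).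
Proof.
move=> dF A B sAB; rewrite !inE => /andP[xB FB].
rewrite (dF _ _ (setUS _ sAB) FB) andbT.
by apply: contra xB; apply: (subsetP sAB).
Qed.

Lemma link_sub_deletion x F : down_closed F -> link x F \subset deletion x F.
Proof.
move=> dF; apply/subsetP => B; rewrite !inE => /andP[-> FB].
by rewrite (dF _ _ (subsetUr _ _) FB).
Qed.

Lemma level0 F : set0 \in F -> level F 0 = 1.
Proof.
move=> F0; apply/eqP/cards1P; exists set0; apply/setP=> B.
by rewrite !inE cards_eq0; case: eqP => [->|]; rewrite ?F0 ?andbF.
Qed.

Lemma level_sub F1 F2 j : F1 \subset F2 -> level F1 j <= level F2 j.
Proof.
move=> s12; apply/subset_leq_card/subsetP => B; rewrite !inE => /andP[FB ->].
by rewrite (subsetP s12 _ FB).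
Qed.

Lemma level_powerset A F j :
  F \subset powerset A -> level F j <= 'C(#|A|, j).
Proof.
move=> FA; rewrite -cards_draws; apply/subset_leq_card/subsetP => B.
by rewrite !inE => /andP[/(subsetP FA) + ->]; rewrite inE => ->.
Qed.

Lemma level_split x F j :
  level F j.+1 = level (deletion x F) j.+1 + level (link x F) j.
Proof.
rewrite /level -(cardsID [set B : {set T} | x \in B]) addnC; congr (_ + _).
  by apply: eq_card => B; rewrite !inE; case: (x \in B) (B \in F) => -[].
rewrite -(@card_in_imset _ _ (fun B => x |: B) [set B in link x F | #|B| == j]).
  apply: eq_card => B; rewrite !inE; apply/andP/imsetP => [[/andP[FB cB] xB]|].
    exists (B :\ x); last by rewrite setD1K.
    by rewrite !inE eqxx setD1K // FB /=; rewrite (cardsD1 x) xB in cB.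
  case=> C; rewrite !inE => /andP[/andP[xC FC] cC] ->.
  by rewrite FC setU11 cardsU1 xC add1n eqSS cC.
move=> B C; rewrite !inE => /andP[/andP[xB _] _] /andP[/andP[xC _] _] eqBC.
by rewrite -(setU1K xB) eqBC setU1K.
Qed.

(** Induction on the vertices: the faces split into the deletion and the link of a vertex [x], both
    living on [A :\ x]. The link lies in the deletion, which accounts for the [minn] in
    [eckhoff_wegner]. *)
Lemma kruskal_katona A F j :
    #|A| <= 10 -> F \subset powerset A -> down_closed F ->
  level F j.+1 <= kk_bound j (level F j).
Proof.
move En: #|A| => n n_le; elim: n n_le => [|n IHn] n_le in A F j En *.
  move=> FA _; have := level_powerset j.+1 FA.
  by rewrite En bin0n leqn0 => /eqP->.
move=> FA dF; have [x xA] : exists x, x \in A by apply/card_gt0P; rewrite En.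
case: j => [|j].
  have [F0|F0] := boolP (set0 \in F); last first.
    suff ->: F = set0 by rewrite /level setIdE set0I cards0.
    apply/setP=> B; rewrite inE; apply: contraNF F0 => FB.
    exact: dF (sub0set B) FB.
  rewrite (level0 F0); apply: leq_trans (_ : 10 <= _); last by vm_compute.
  by apply: leq_trans (level_powerset 1 FA) _; rewrite En bin1.
have EA : #|A :\ x| = n by move: En; rewrite (cardsD1 x) xA => -[].
have delA : deletion x F \subset powerset (A :\ x).
  apply/subsetP=> B; rewrite !inE => /andP[/(subsetP FA) + xB].
  by rewrite inE subsetD1 => ->.
have linkA := subset_trans (link_sub_deletion x dF) delA.
(* Beyond the checked range, the faces counted on the left would have at least 11 vertices. *)
have [j_lt|j_ge] := ltnP j 9; last first.
  have := level_powerset j.+2 FA; rewrite En bin_small ?leqn0; last by lia.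
  by move/eqP->.
rewrite (level_split x) (level_split x F j).
have bin_n i : 'C(n, i) <= 'C(9, i) by apply: leq_bin2l.
apply: leq_trans (eckhoff_wegner j_lt _ _); first 1 last.
- by apply: leq_trans (level_powerset _ delA) _; rewrite EA.
- by apply: leq_trans (level_powerset _ linkA) _; rewrite EA.
apply: leq_add.
  exact: IHn (ltnW n_le) _ _ _ EA delA (down_closed_deletion dF).
rewrite leq_min level_sub ?link_sub_deletion //.
exact: IHn (ltnW n_le) _ _ _ EA linkA (down_closed_link dF).
Qed.

End Complexes.

Local Open Scope ring_scope.

(** * The passage from [alpha] to [beta], for arbitrary sequences *)

Definition transform (a : nat -> int) (q k : nat) : int :=
  \sum_(j < k.+1) (-1) ^+ (k - j)%N * ('C(q - j, k - j))%:Z * a j.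

Lemma transform0 a q : transform a q 0 = a 0%N.
Proof. by rewrite /transform big_ord1 subnn bin0 !mul1r. Qed.

(* Truncated subtraction: 'C(q - q.+1, 0) = 1, so only the last term remains. *)
Lemma transform_diag a q : transform a q q.+1 = a q.+1.
Proof.
rewrite /transform big_ord_recr /= subnn bin0 !mul1r big1 ?add0r // => i _.
by rewrite bin_small ?mulr0 ?mul0r //; have := ltn_ord i; lia.
Qed.

Lemma transform_pascal a q k : (k <= q)%N ->
  transform a q.+1 k.+1 = transform a q k.+1 - transform a q k.
Proof.
move=> k_le; rewrite /transform big_ord_recr [X in _ = X - _]big_ord_recr /=.
rewrite !subnn !bin0 addrAC; congr (_ + _); rewrite -sumrB.
apply: eq_bigr => i _; have i_le : (i <= k)%N by rewrite -ltnS.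
rewrite !subSn ?(leq_trans i_le) // binS exprS PoszD; ring.
Qed.

Lemma transformB a b q k :
  transform (fun j => a j - b j) q k = transform a q k - transform b q k.
Proof. by rewrite /transform -sumrB; apply: eq_bigr => i _; rewrite mulrBr. Qed.

(** The sum over j of C(n, j) t^j (1 - t)^(q - j) is (1 - t)^(q - n); compare coefficients of t^k.
    At [k = 0] the truncated [k.-1] is harmless. *)
Lemma transform_binomial n q k : (q <= n)%N -> (k <= q.+1)%N ->
  transform (fun j => ('C(n, j))%:Z) q k = ('C(n - q + k.-1, k))%:Z.
Proof.
elim: q k => [|q IHq] [|k] //= q_lt k_le; rewrite ?transform0 ?bin0 //.
  move: k_le; rewrite ltnS leqn0 => /eqP->.
  by rewrite transform_diag subn0 addn0.
move: k_le; rewrite ltnS leq_eqVlt => /predU1P[->|]; last rewrite ltnS => k_le.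
  by rewrite transform_diag; congr (Posz 'C(_, _)); lia.
rewrite transform_pascal // !IHq ?(ltnW q_lt) ?(leqW k_le) //=.
case: k k_le => [|k] k_le; first by rewrite !bin1 bin0; lia.
have -> : (n - q + k.+1 = (n - q.+1 + k.+1).+1)%N by lia.
have -> : (n - q + k.+1.-1 = n - q.+1 + k.+1)%N by lia.
by rewrite binS PoszD addrK.
Qed.

(** * Exhaustive search over the admissible vectors *)

(* With r = m + j, the list col stands for b(r, j), b(r - 1, j), ..., b(j, j),
   and f for f_j; v ranges over the values of b(r + 1, j + 1) allowed by the
   Kruskal-Katona bound. As 10 - m = 10 - r + j, the binomial coefficient is the
   value of b(r, j + 1) for the full simplex on 10 vertices. *)
Fixpoint explore (m j : nat) (col : seq nat) (f : nat) : bool :=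
  if m is m'.+1 then
    let base := sumn col in
    let top := kk_bound j f in
    (top < base)%N ||
    (top - base + head 0%N col <= 'C(10 - m, j.+1))%N &&
    all (fun v => explore m' j.+1
            (mkseq (fun t => v + sumn (take t.+1 col)) m) (v + base))
        (iota 0 (top - base).+1)
  else true.

(** The initial column is constant because b(q, 0) = f_0 = 1. *)
Lemma exploreP r : (r < 10)%N -> explore r 0 (nseq r.+1 1%N) 1.
Proof.
have /allP check : all (fun r => explore r 0 (nseq r.+1 1%N) 1) (iota 0 10).
  by vm_compute.
by move=> r_lt; apply: check; rewrite mem_iota.
Qed.

Section Exploration.

Variables (f : nat -> nat) (r : nat).
Let B := transform (fun j => (f j)%:Z).

Hypothesis r_le : (r <= 10)%N.
Hypothesis f_kk : forall j, (f j.+1 <= kk_bound j (f j))%N.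
Hypothesis B_ge0 : forall k, (k <= r.+1)%N -> 0 <= B r.+1 k.

(** The actual b(r + 1, j + 1) is among the values tried, since adding [sumn col] to it gives
    f_(j+1). Adding the head of [col] instead gives b(r, j + 1), so testing the largest value covers
    all of them. *)
Lemma explore_bound m j col :
    (m + j = r)%N -> size col = m.+1 ->
    (forall t, (t <= m)%N -> (nth 0%N col t)%:Z = B (r - t) j) ->
    explore m j col (f j) ->
  forall k, (j < k <= r)%N -> B r k <= ('C(10 - r + k.-1, k))%:Z.
Proof.
elim: m j col => [|m IHm] j col mjr col_size colE.
  by move=> _ k /andP[]; lia.
set v := `|B r.+1 j.+1|%N.
have vE : v%:Z = B r.+1 j.+1 by rewrite gez0_abs ?B_ge0 //; lia.
(* Pascal's rule telescopes: b(r - t, j + 1) = b(r + 1, j + 1) + b(r, j) + ... + b(r - t, j). *)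
have stepE t : (t <= m.+1)%N -> (v + sumn (take t.+1 col))%:Z = B (r - t) j.+1.
  elim: t => [|t IHt] t_le.
    rewrite subn0 (take_nth 0%N) ?col_size // take0 /= addn0.
    by rewrite PoszD vE colE // subn0 /B transform_pascal ?subrK //; lia.
  rewrite (take_nth 0%N) ?col_size // sumn_rcons addnA PoszD.
  rewrite IHt ?(ltnW t_le) // colE // -subnSK; last by lia.
  by rewrite /B transform_pascal ?subrK //; lia.
(* At the last [t] the index r - t equals j, and b(j, j + 1) = f_(j+1). *)
have fE : f j.+1 = (v + sumn col)%N.
  have := stepE m.+1 (leqnn _); rewrite take_oversize ?col_size // -mjr addKn.
  by rewrite /B transform_diag => -[].
have v_le : (f j.+1 <= kk_bound j (f j))%N := f_kk j.
have hd_eq : B r j.+1 = (v + head 0%N col)%:Z.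
  rewrite -[r in LHS]subn0 -stepE // (take_nth 0%N) ?col_size //.
  by rewrite take0 /= addn0 nth0.
(* The pruned branch is impossible: f_(j+1) would exceed its Kruskal-Katona bound. *)
case/orP=> [|/andP[bound /allP rec]]; first by lia.
move=> k /andP[]; rewrite leq_eqVlt => /predU1P[<- _ | jk kr].
  have -> : (10 - r + j.+1.-1 = 10 - m.+1)%N by lia.
  by rewrite hd_eq lez_nat; lia.
apply: (IHm j.+1 (mkseq (fun t => v + sumn (take t.+1 col))%N m.+1));
  rewrite ?jk ?kr ?size_mkseq //; first by lia.
  by move=> t t_le; rewrite nth_mkseq ?stepE //; lia.
by rewrite fE; apply: rec; rewrite mem_iota; lia.
Qed.

End Exploration.

Lemma transform_bound (f : nat -> nat) r :
    (r < 10)%N -> f 0%N = 1%N ->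
    (forall j, (f j.+1 <= kk_bound j (f j))%N) ->
    (forall k, (k <= r.+1)%N -> 0 <= transform (fun j => (f j)%:Z) r.+1 k) ->
  forall k, (k <= r)%N ->
    0 <= transform (fun j => ('C(10, j))%:Z - (f j)%:Z) r k.
Proof.
move=> r_lt f0 f_kk pos k kr; rewrite transformB subr_ge0.
rewrite transform_binomial //; last 2 first.
- exact: ltnW.
- exact: leqW.
case: k kr => [|k] kr; first by rewrite transform0 bin0 f0.
apply: (@explore_bound f r (ltnW r_lt) f_kk pos r 0 (nseq r.+1 1%N));
  rewrite ?addn0 ?size_nseq ?kr //; last by rewrite f0; apply: exploreP.
by move=> t t_le; rewrite nth_nseq ltnS t_le transform0 f0.
Qed.

(** * From squarefree monomials to sets of variables *)

Section Ideal.

Variables (K : fieldType) (n : nat).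
Implicit Types (I J : {pred {mpoly K[n]}}) (A B : {set 'I_n}).

Definition set_mnm B : 'X_{1..n} := [multinom nat_of_bool (i \in B) | i < n].

Lemma mdeg_set_mnm B : mdeg (set_mnm B) = #|B|.
Proof.
rewrite mdegE -sum1_card [RHS]big_mkcond /=.
by apply: eq_bigr => i _; rewrite mnmE; case: (i \in B).
Qed.

Lemma squarefree_set_mnm B : squarefree_mnm (set_mnm B).
Proof. by apply/forallP=> i; rewrite mnmE leq_b1. Qed.

Lemma squarefreeE (m : 'X_{1..n}) :
  squarefree_mnm m -> m = set_mnm [set i | m i != 0%N].
Proof.
move=> /forallP m_le; apply/mnmP=> i; rewrite mnmE inE.
by case: (m i) (m_le i) => [|[]].
Qed.

Lemma alphaE I J j :
  alpha J I j = #|[set B : {set 'I_n} | [&& #|B| == j,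
    'X_[K, set_mnm B] \in J & 'X_[K, set_mnm B] \notin I]]|.
Proof.
pose supp (m : 'X_{1..n < n.+1}) := [set i | m i != 0%N].
rewrite /alpha -(@card_in_imset _ _ supp) => [|m1 m2]; last first.
  rewrite !inE => /and4P[/squarefreeE m1E _ _ _] /and4P[/squarefreeE m2E _ _ _].
  by move=> eq12; apply/val_inj; rewrite /= m1E m2E; congr set_mnm.
apply: eq_card => B; rewrite [RHS]inE; apply/imsetP/and3P => [[m]|[cB JB IB]].
  rewrite inE => /and4P[/squarefreeE mE dm Jm Im] ->.
  by rewrite -mdeg_set_mnm -mE.
have degB : (mdeg (set_mnm B) < n.+1)%N.
  by rewrite mdeg_set_mnm ltnS -[n in (_ <= n)%N]card_ord max_card.
exists (BMultinom degB); last by apply/setP=> i; rewrite inE mnmE eqb0 negbK.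
by rewrite inE squarefree_set_mnm mdeg_set_mnm cB JB.
Qed.

(** The Stanley-Reisner complex when [I] is a squarefree monomial ideal. *)
Definition standard_sets I : {set {set 'I_n}} :=
  [set B | 'X_[K, set_mnm B] \notin I].

Lemma alpha_quotient I j : alpha predT I j = level (standard_sets I) j.
Proof. by rewrite alphaE; apply: eq_card => B; rewrite !inE andbC. Qed.

Lemma alpha_ideal I j :
  (alpha I (pred1 0) j)%:Z = ('C(n, j))%:Z - (level (standard_sets I) j)%:Z.
Proof.
apply/eqP; rewrite eq_sym subr_eq -PoszD eqz_nat alphaE.
rewrite -[n in 'C(n, _)]card_ord -card_draws addnC.
rewrite -(cardsID (standard_sets I)) /level; apply/eqP; congr (_ + _)%N.
  by apply: eq_card => B; rewrite !inE andbC.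
apply: eq_card => B; rewrite !inE negbK -msupp_eq0 msuppX andbT.
by rewrite andbC.
Qed.

Lemma ideal_mul I p q : squarefree_monomial_ideal I -> q \in I -> p * q \in I.
Proof.
case=> G _ IE /IE[c ->]; apply/IE; exists (fun m => p * c m).
by rewrite mulr_sumr; apply: eq_bigr => m _; rewrite mulrA.
Qed.

Lemma down_closed_standard_sets I :
  squarefree_monomial_ideal I -> down_closed (standard_sets I).
Proof.
move=> hI A B sAB; rewrite !inE; apply: contra => IA.
have -> : set_mnm B = (set_mnm (B :\: A) + set_mnm A)%MM.
  apply/mnmP=> i; rewrite mnmDE !mnmE inE.
  by have := subsetP sAB i; case: (i \in A) => [/(_ isT)->|_]; rewrite ?addn0.
by rewrite mpolyXD; apply: ideal_mul.
Qed.

Lemma set0_standard I :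
    squarefree_monomial_ideal I -> ~ (I =i predT) -> set0 \in standard_sets I.
Proof.
move=> hI nI; rewrite inE; apply/negP => I1; apply: nI => p; rewrite inE.
have m0 : set_mnm set0 = 0%MM by apply/mnmP=> i; rewrite mnmE inE mnm0E.
by rewrite m0 mpolyX0 in I1; rewrite -[p]mulr1 (ideal_mul p hI I1).
Qed.

End Ideal.

Theorem corollary3p8 (K : fieldType) (I : {pred {mpoly K[10]}})
  (hI : squarefree_monomial_ideal I)
  (I_neq0 : ~ (I =i pred1 0))
  (I_neqS : ~ (I =i predT)) :
  (hdepth predT I)%:Z - 1 <= (hdepth I (pred1 0))%:Z.
Proof.
pose f := level (standard_sets I).
have f_kk j : (f j.+1 <= kk_bound j (f j))%N.
  apply: (kruskal_katona (A := setT)); rewrite ?cardsT ?card_ord //.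
    by apply/subsetP=> B _; rewrite inE subsetT.
  exact: down_closed_standard_sets.
have f0 : f 0%N = 1%N by apply/level0/set0_standard.
rewrite lerBlDr -PoszD lez_nat /hdepth addn1.
(* A candidate 0 for S/I is trivial; a candidate r + 1 makes r a candidate for [I]. *)
apply/bigmax_leqP => -[[//|r] r_lt] /forallP pos; rewrite ltnS.
apply: (leq_bigmax_cond (Ordinal (ltnW r_lt))); apply/forallP=> k.
have -> : beta I (pred1 0) r k =
    transform (fun j => ('C(10, j))%:Z - (f j)%:Z) r k.
  by apply: eq_bigr => j _; rewrite alpha_ideal.
apply: (transform_bound r_lt f0 f_kk) (ltn_ord k) => i i_le.
have := pos (@Ordinal r.+2 i i_le); rewrite /beta.
by under eq_bigr do rewrite alpha_quotient.
Qed.
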